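(* Let $n,a,b\ge 1$ be integers and let $K_n$ be the complete graph with $n$ vertices. For $k\ge 0$ let $f_k$ be the number of faces with $k$ vertices of the legal complex of the weight game $W(a,b)$ played on $K_n$, i.e. the number of legal positions with exactly $k$ pieces. Then for all $k\ge 0$ $$f_k=\sum_{l=0}^{k}\left(\frac{\prod_{i=0}^{k-l-1}\binom{n-ia}{a}}{(k-l)!}\right)\left(\frac{\prod_{j=0}^{l-1}\binom{n-(k-l)a-jb}{b}}{l!}\right).$$
   Context: The weight game $W(a,b)$ on a graph $B$ (the board) is the following two-player game. Starting with the empty board, Left places pieces of weight $a$ and Right places pieces of weight $b$; a piece of weight $w$ covers a connected set of $w$ vertices (inducing a connected subgraph of $B$), all of which must be empty when the piece is placed. Pieces are never moved or removed, and there are no further rules. Left and Right pieces are distinguishable by owner, even when $a=b$. A position is a set of pieces on the board, each piece being determined by its owner and the set of vertices it covers. It is legal exactly when the pieces cover pairwise disjoint vertex sets; order of play is irrelevant, and moves need not alternate. On $K_n$ a piece of weight $w$ can cover any $w$-element set of vertices. The legal complex is the simplicial complex whose faces are the legal positions (vertices are the legal one-piece positions), and $f_k$ denotes the number of faces with $k$ vertices, i.e. of legal positions with exactly $k$ pieces (so $f_0=1$). Conventions: empty products equal $1$, and $\binom{m}{w}=0$ whenever $m<w$ (including negative $m$). *)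

(* Defs.v *)
From HB Require Import structures.
From mathcomp Require Import all_boot all_order all_algebra.

Set Implicit Arguments.
Unset Strict Implicit.
Unset Printing Implicit Defensive.

Variant player := Left | Right.

Definition bool_of_player (p : player) : bool := if p is Left then true else false.
Definition player_of_bool (b : bool) : player := if b then Left else Right.

Lemma bool_of_playerK : cancel bool_of_player player_of_bool.
Proof. by case. Qed.

HB.instance Definition _ := Finite.copy player (can_type bool_of_playerK).

Record board := Board {
  vertex :> finType;
  adj : rel vertex;
  adj_sym : symmetric adj;
  adj_irr : irreflexive adj }.

Definition complete_adj (n : nat) : rel 'I_n := fun i j => i != j.

Lemma complete_adj_sym n : symmetric (@complete_adj n).
Proof. by move=> i j; rewrite /complete_adj eq_sym. Qed.

Lemma complete_adj_irr n : irreflexive (@complete_adj n).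
Proof. by move=> i; rewrite /complete_adj eqxx. Qed.

Definition complete_board (n : nat) : board :=
  Board (@complete_adj_sym n) (@complete_adj_irr n).

(* The empty set counts as connected here; it never occurs as the support of
   a piece of weight at least 1. *)
Definition induces_connected (B : board) (A : {set B}) : bool :=
  [forall x in A, forall y in A,
    connect [rel u v | [&& u \in A, v \in A & adj u v]] x y].

Section WeightGame.

Variables (B : board) (a b : nat).

Definition piece : finType := (player * {set B})%type.

Definition owner (p : piece) : player := p.1.
Definition support (p : piece) : {set B} := p.2.

Definition weight (p : player) : nat := if p is Left then a else b.

Definition valid_piece (p : piece) : bool :=
  (#|support p| == weight (owner p)) && induces_connected (support p).

(* Disjointness is required of distinct pieces, not of distinct supports: a
   Left and a Right piece on the same vertices overlap. *)
Definition legal (P : {set piece}) : bool :=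
  [forall p in P, valid_piece p] &&
  [forall p in P, forall q in P,
     (p != q) ==> [disjoint support p & support q]].

End WeightGame.

(* A vertex of the complex is an x : V such that [set x] is a face; elements
   of the ambient type V need not be vertices. *)
Record simplicial_complex (V : finType) := SimplicialComplex {
  faces :> {set {set V}};
  face_set0 : set0 \in faces;
  face_subset : forall F G : {set V}, G \in faces -> F \subset G -> F \in faces }.

(* Number of faces with k vertices, that is, of dimension k - 1. *)
Definition face_number (V : finType) (D : simplicial_complex V) (k : nat) : nat :=
  #|[set F in faces D | #|F| == k]|.

Section LegalComplex.

Variables (B : board) (a b : nat).

Definition legal_positions : {set {set piece B}} := [set P | legal a b P].

Lemma legal_positions0 : set0 \in legal_positions.
Proof.
by rewrite inE; apply/andP; split; apply/forall_inP => p; rewrite inE.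
Qed.

Lemma legal_positions_subset (P Q : {set piece B}) :
  Q \in legal_positions -> P \subset Q -> P \in legal_positions.
Proof.
rewrite !inE => /andP[/forall_inP vQ /forall_inP dQ] /subsetP sPQ.
apply/andP; split; apply/forall_inP => p /sPQ pQ; first exact: vQ.
by apply/forall_inP => q /sPQ qQ; move/forall_inP: (dQ p pQ); apply.
Qed.

Definition legal_complex : simplicial_complex (piece B) :=
  SimplicialComplex legal_positions0 legal_positions_subset.

End LegalComplex.

(* Main.v *)
(* On a complete board connectivity is vacuous, so a legal position with m Left
   and l Right pieces leaves n - (m a + l b) free vertices and extends by a piece
   of weight w in 'C(n - (m a + l b), w) ways.  Counting positions with a marked
   piece of a given owner in two ways turns this into a recursion; first adding
   the Left pieces, then the Right ones, gives the number of positions of each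
   profile (m, l), and f_k sums these over m + l = k. *)
Require Import Defs.
From mathcomp Require Import all_boot all_order all_algebra.
Import Order.TTheory GRing.Theory Num.Theory.
Local Open Scope ring_scope.

Set Implicit Arguments.
Unset Strict Implicit.
Unset Printing Implicit Defensive.

Lemma complete_induces_connected (n : nat) (A : {set complete_board n}) :
  induces_connected A.
Proof.
apply/forall_inP => x xA; apply/forall_inP => y yA.
have [-> | xy] := eqVneq x y; first exact: connect0.
by apply: connect1; rewrite /= xA yA.
Qed.

Lemma big_player (R : Type) (idx : R) (op : Monoid.com_law idx)
    (F : player -> R) :
  \big[op/idx]_(o : player) F o = op (F Left) (F Right).
Proof.
rewrite (bigD1 Left) //= (bigD1 Right) //= big1 ?Monoid.mulm1 //.
by case.
Qed.

Definition owned {B : board} (o : player) (P : {set piece B}) : {set piece B} :=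
  [set x in P | owner x == o].

(** A profile is a function of the owner, so that one recursion serves both players. *)
Definition positions (B : board) (a b : nat) (m : player -> nat) :
    {set {set piece B}} :=
  [set P | legal a b P & [forall o, #|owned o P| == m o]].

(** The condition tying [x] to [P] involves only the union of the supports in [P], which is what
    makes extensions countable. *)
Lemma legalU1 (B : board) (a b : nat) (x : piece B) (P : {set piece B}) :
  x \notin P ->
  legal a b (x |: P) =
  [&& legal a b P, valid_piece a b x &
      [disjoint Defs.support x & \bigcup_(y in P) Defs.support y]].
Proof.
move=> xP; apply/andP/and3P.
  case=> /forall_inP vQ /forall_inP dQ; split.
  - apply/andP; split; apply/forall_inP => y yP.
      by apply: vQ; rewrite setU1r.
    apply/forall_inP => z zP.
    by move/forall_inP: (dQ y (setU1r _ yP)); apply; rewrite setU1r.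
  - by apply: vQ; rewrite setU11.
  - apply/bigcup_disjointP => y yP.
    move/forall_inP: (dQ x (setU11 _ _)) => /(_ y (setU1r _ yP)) /implyP; apply.
    by apply: contraNneq xP => ->.
case=> /andP[/forall_inP vP /forall_inP dP] vx /bigcup_disjointP dx.
split; apply/forall_inP => y.
  by case/setU1P => [-> // | /vP].
case/setU1P => [-> | yP]; apply/forall_inP => z /setU1P[-> | zP]; apply/implyP.
- by rewrite eqxx.
- by move=> _; apply: dx.
- by rewrite disjoint_sym => _; apply: dx.
- by move/forall_inP: (dP y yP) => /(_ z zP) /implyP.
Qed.

Lemma card_ownedU1 (B : board) (o : player) (x : piece B) (P : {set piece B}) :
  x \notin P -> #|owned o (x |: P)| = ((o == owner x) + #|owned o P|)%N.
Proof.
move=> xP; have [-> | ox] := eqVneq o (owner x).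
  have -> : owned (owner x) (x |: P) = x |: owned (owner x) P.
    by apply/setP => y; rewrite !inE; case: eqP => // ->; rewrite eqxx.
  by rewrite cardsU1 inE (negbTE xP).
apply: eq_card => y; rewrite !inE.
by have [->|] := eqVneq y x; rewrite ?(eq_sym (owner x)) ?(negbTE ox) ?andbF.
Qed.

(** Supports of distinct pieces are disjoint, so their sizes add up; grouping the sum by owner
    leaves only the profile. *)
Lemma card_covered (B : board) (a b : nat) (m : player -> nat)
    (P : {set piece B}) :
  P \in positions B a b m ->
  #|\bigcup_(x in P) Defs.support x| = (\sum_o m o * weight a b o)%N.
Proof.
rewrite inE => /andP[/andP[/forall_inP vP /forall_inP dP] /forallP mP].
(* The union is taken over all pieces, those outside [P] contributing [set0], which is disjoint from
   everything. *)
rewrite big_mkcond -sum1_card partition_disjoint_bigcup /=; last first.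
  move=> x y xy; case: ifP => xP; last by rewrite disjoints_subset sub0set.
  case: ifP => yP; last by rewrite disjoint_sym disjoints_subset sub0set.
  by move/forall_inP: (dP x xP) => /(_ y yP) /implyP; apply.
rewrite (partition_big (@owner B) predT) //=.
apply: eq_bigr => o _; rewrite -(eqP (mP o)) -sum_nat_const big_mkcond /=.
rewrite [RHS]big_mkcond /=; apply: eq_bigr => x _; rewrite inE sum1_card.
have [xP | _] := boolP (x \in P); last by rewrite cards0 if_same.
by have [<- | //] := eqVneq; case/andP: (vP x xP) => /eqP.
Qed.

Section CompleteBoard.

Variables (n a b : nat).
Hypotheses (a_gt0 : (0 < a)%N) (b_gt0 : (0 < b)%N).

Local Notation B := (complete_board n).
Local Notation positions := (positions B a b).

Let weight_gt0 o : (0 < weight a b o)%N. Proof. by case: o. Qed.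

(** The clause [x \notin P] excludes pieces already present, for which [x |: P] is just [P]. *)
Definition extension (o : player) (P : {set piece B}) (x : piece B) : bool :=
  [&& owner x == o, x \notin P & legal a b (x |: P)].

(** The extensions by [o] are the pairs [(o, A)] with [A] a subset of the right size in the
    complement of the covered set [C]. *)
Lemma card_extension (m : player -> nat) (o : player) (P : {set piece B}) :
  P \in positions m ->
  #|[set x | extension o P x]| =
  'C(n - \sum_o' m o' * weight a b o', weight a b o).
Proof.
move=> Pm; have lP : legal a b P by move: Pm; rewrite inE => /andP[].
rewrite -(card_covered Pm); set C := \bigcup_(_ in _) _.
have -> : (n - #|C|)%N = #|~: C| by rewrite [RHS]cardsCs setCK /= card_ord.
rewrite -cards_draws -[RHS](@card_imset _ _ (pair o)); last by move=> ? ? [].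
apply: eq_card => -[o' A]; rewrite inE.
apply/and3P/imsetP => [[/eqP /= -> xP] | [A' + [-> ->]]].
  rewrite legalU1 // => /and3P[_ /andP[wA _] dA]; exists A => //.
  by rewrite inE -disjoints_subset dA.
rewrite inE -disjoints_subset => /andP[dA wA].
(* Positive weight makes [A'] nonempty, so a copy of this piece in [P] would put a vertex of [A']
   into [C]. *)
have xP : (o, A') \notin P.
  apply/negP => xP; have /set0Pn[v vA] : A' != set0.
    by rewrite -card_gt0 (eqP wA).
  have vC : v \in C by apply/bigcupP; exists (o, A').
  by move/pred0P: dA => /(_ v); rewrite /= vA vC.
split=> //; rewrite legalU1 // lP dA andbT /=.
by rewrite /valid_piece wA complete_induces_connected.
Qed.

(* Both sides count the positions Q of profile m' with a marked piece x owned
   by o; the right-hand side sees Q as x |: P. *)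
Lemma card_positions_step (m m' : player -> nat) (o : player) :
  (forall o', m' o' = (o' == o) + m o')%N ->
  (#|positions m'| * m' o =
   #|positions m| * 'C(n - \sum_o' m o' * weight a b o', weight a b o))%N.
Proof.
move=> m'E.
transitivity (\sum_(Q in positions m') \sum_(x in owned o Q) 1)%N.
  rewrite -sum_nat_const; apply: eq_bigr => Q.
  by rewrite inE sum1_card => /andP[_ /forallP/(_ o)/eqP].
transitivity (\sum_(P in positions m) \sum_(x | extension o P x) 1)%N; last first.
  rewrite -sum_nat_const; apply: eq_bigr => P Pm.
  by rewrite -(card_extension o Pm) -sum1_card; apply: eq_bigl => x; rewrite inE.
rewrite !pair_big_dep /=.
rewrite (reindex_onto (fun u => (u.2 |: u.1, u.2)) (fun u => (u.1 :\ u.2, u.2)));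
  last first.
  by move=> [Q x] /= /andP[_]; rewrite inE => /andP[xQ _]; rewrite setD1K.
apply: eq_bigl => -[P x] /=; rewrite xpair_eqE eqxx andbT /extension.
(* If [x] is in [P], then [(x |: P) :\ x] differs from [P], so the pair is excluded on both
   sides. *)
have [xP | xP] := boolP (x \in P).
  rewrite /= !andbF; apply/negP => /andP[_ /eqP PE].
  by move: xP; rewrite -PE setD11.
rewrite setU1K // eqxx andbT /= !inE eqxx /= andbC.
case: eqP => [ox | _]; last by rewrite andbF.
rewrite andTb legalU1 //.
have -> : [forall o', #|owned o' (x |: P)| == m' o'] =
          [forall o', #|owned o' P| == m o'].
  by apply: eq_forallb => o'; rewrite card_ownedU1 // ox m'E eqn_add2l.
by case: (legal a b P); rewrite //= ?andbF // andbC.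
Qed.

Definition profile (p q : nat) (o : player) : nat := if o is Left then p else q.

Lemma card_positions00 : #|positions (profile 0 0)| = 1%N.
Proof.
rewrite -(cards1 (set0 : {set piece B})).
apply: eq_card => P; rewrite !inE.
apply/andP/eqP => [[_ /forallP P0] | ->].
  apply/setP => x; rewrite !inE; apply/negP => xP.
  have : x \in owned (owner x) P by rewrite inE xP eqxx.
  have /eqP := P0 (owner x).
  have -> : profile 0 0 (owner x) = 0%N by case: (owner x).
  by move/cards0_eq ->; rewrite inE.
split; first by have := legal_positions0 B a b; rewrite inE.
apply/forallP => o; have -> : profile 0 0 o = 0%N by case: o.
by rewrite cards_eq0; apply/eqP/setP => x; rewrite !inE.
Qed.

(** Iterating the recursion on [Left] accumulates the marking factors into [p!]. Where [n - i * a]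
    truncates to 0 the binomial vanishes, since [a] is positive. *)
Lemma card_positions_Left (p : nat) :
  (#|positions (profile p 0)| * p`! = \prod_(0 <= i < p) 'C(n - i * a, a))%N.
Proof.
elim: p => [|p IHp]; first by rewrite card_positions00 big_geq.
rewrite big_nat_recr //= -IHp factS mulnA.
rewrite (@card_positions_step (profile p 0) (profile p.+1 0) Left); last by case.
by rewrite big_player /= mul0n addn0 mulnAC.
Qed.

Lemma card_positions (p q : nat) :
  (#|positions (profile p q)| * (p`! * q`!) =
   (\prod_(0 <= i < p) 'C(n - i * a, a)) *
   \prod_(0 <= j < q) 'C(n - p * a - j * b, b))%N.
Proof.
elim: q => [|q IHq].
  by rewrite fact0 muln1 card_positions_Left [X in (_ * X)%N]big_geq ?muln1.
rewrite big_nat_recr //= [RHS]mulnA -IHq factS (mulnCA p`!) mulnA.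
rewrite (@card_positions_step (profile p q) (profile p q.+1) Right); last by case.
by rewrite big_player /= subnDA mulnAC.
Qed.

Lemma face_number_profile (k : nat) :
  face_number (legal_complex B a b) k =
  (\sum_(0 <= l < k.+1) #|positions (profile (k - l) l)|)%N.
Proof.
have cardP (P : {set piece B}) : (#|owned Left P| + #|owned Right P|)%N = #|P|.
  rewrite -[RHS]sum1_card (partition_big (@owner B) predT) //= big_player /=.
  by rewrite -!sum1_card; congr addn; apply: eq_bigl => x; rewrite inE.
rewrite /face_number -sum1_card big_mkord.
(* The default value of [inord] never occurs: a face with [k] pieces has at most [k] Right
   pieces. *)
rewrite (partition_big (fun P => inord #|owned Right P| : 'I_k.+1) predT) //=.
apply: eq_bigr => l _; rewrite -sum1_card; apply: eq_bigl => P.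
rewrite !inE -andbA; congr andb; rewrite -cardP -val_eqE /=.
apply/andP/forallP => [[/eqP kE lE] | mP].
  rewrite inordK -?kE ?ltnS ?leq_addl // in lE.
  by case=> //=; rewrite -(eqP lE) -kE addnK.
have := mP Left; have := mP Right => /= /eqP -> /eqP ->.
by rewrite inord_val subnK ?eqxx // -ltnS.
Qed.

End CompleteBoard.

Theorem proposition6p1 (n a b : nat) (hn : (1 <= n)%N) (ha : (1 <= a)%N)
    (hb : (1 <= b)%N) (k : nat) :
  (face_number (legal_complex (complete_board n) a b) k)%:R =
  \sum_(0 <= l < k.+1)
    ((\prod_(0 <= i < k - l) 'C(n - i * a, a)%:R) / ((k - l)`!)%:R) *
    ((\prod_(0 <= j < l) 'C(n - (k - l) * a - j * b, b)%:R) / (l`!)%:R) :> rat.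
Proof.
rewrite face_number_profile natr_sum; apply: eq_bigr => l _.
(* Numerators and inverse factorials are gathered separately; [card_positions] then turns the
   numerator into the count times both factorials, which cancel. *)
rewrite -!natr_prod mulrACA -natrM -(card_positions n ha hb) -invfM -natrM natrM.
by rewrite mulfK // pnatr_eq0 -lt0n muln_gt0 !fact_gt0.
Qed.
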